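(* Let $p$ be a prime, let $a\in\mathbb{Q}_p$ with $|a|_p>1$, and suppose that $\sqrt{|a|_p}\notin\{p^k : k\in\mathbb{N}\}$. Let $f(x)=x^3+ax^2$ on $\mathbb{Q}_p$, with fixed point $x_1=0$ and other fixed points $x_2,x_3$ (the roots of $x^2+ax-1=0$), labelled so that $x_2$ is repelling and $x_3$ is indifferent. Put $r_k=|a|_p^{-k}$ for $k\ge 0$. Then $$A(x_1)=B_{r_1}(0)\cup D\big[S_{r_0}(0)\cup S_{|a|_p}(0),\,B_{r_3}(-a)\big],$$ and for the indifferent fixed point $x_3$ one has $SI(x_3)=B_{r_1}(x_3)$.
   Context: $|\cdot|_p$ is the $p$-adic norm on $\mathbb{Q}_p$. For $c\in\mathbb{Q}_p$, $r>0$: $B_r(c)=\{x\in\mathbb{Q}_p:|x-c|_p<r\}$, $\bar B_r(c)=\{x\in\mathbb{Q}_p:|x-c|_p\le r\}$, $S_r(c)=\{x\in\mathbb{Q}_p:|x-c|_p=r\}$. $f^{(n)}$ denotes the $n$-fold iterate of $f$ ($f^{(0)}=\mathrm{id}$). For a fixed point $x^{(0)}$ of $f$ with $\lambda=f'(x^{(0)})$: it is attractive if $0\le|\lambda|_p<1$, indifferent if $|\lambda|_p=1$, repelling if $|\lambda|_p>1$. The basin of attraction is $A(x^{(0)})=\{y\in\mathbb{Q}_p: f^{(n)}(y)\to x^{(0)},\ n\to\infty\}$. A ball $B_r(x^{(0)})$ is a Siegel disc (centered at $x^{(0)}$) if for every $\rho<r$ the sphere $S_\rho(x^{(0)})$ is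 invariant, i.e. $x\in S_\rho(x^{(0)})$ implies $f^{(n)}(x)\in S_\rho(x^{(0)})$ for all $n\ge1$. $SI(x^{(0)})$ denotes the union of all Siegel discs centered at $x^{(0)}$. For sets $A,B\subset\mathbb{Q}_p$, $D[A,B]=\{x\in A:\ \text{there is an integer } k\ge 0 \text{ with } f^{(k)}(x)\in B\}$. When $|a|_p>1$ the element $a^2+4$ is a square in $\mathbb{Q}_p$, so $x_2,x_3\in\mathbb{Q}_p$. *)

(* Defs.v *)
From HB Require Import structures.
From mathcomp Require Import all_boot all_order all_algebra.
From mathcomp Require Import all_classical all_reals all_analysis.
From mathcomp Require Import ring lra.
Import Order.TTheory GRing.Theory Num.Theory.
Import numFieldNormedType.Exports.

Set Implicit Arguments.
Unset Strict Implicit.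
Unset Printing Implicit Defensive.

Local Open Scope classical_set_scope.
Local Open Scope ring_scope.

Definition rat_padic_norm (p : nat) (x : rat) : rat :=
  if x == 0 then 0
  else p%:R ^ ((logn p `|denq x|)%:Z - (logn p `|numq x|)%:Z).

Section RatNorm.
Variables (p : nat) (p_pr : prime p).
Local Notation nv := (rat_padic_norm p).
Implicit Types x y : rat.

Let p_gt0 : 0 < p%:R :> rat. Proof. by rewrite ltr0n prime_gt0. Qed.
Let p_gt1 : 1 < p%:R :> rat. Proof. by rewrite ltr1n prime_gt1. Qed.
Let p_neq0 : p%:R != 0 :> rat. Proof. exact: lt0r_neq0. Qed.

Lemma rat_padic_norm0 : nv 0 = 0.
Proof. by rewrite /rat_padic_norm eqxx. Qed.

Lemma rat_padic_norm_ge0 x : 0 <= nv x.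
Proof.
by rewrite /rat_padic_norm; case: eqP.
Qed.

Lemma rat_padic_norm_eq0 x : (nv x == 0) = (x == 0).
Proof.
rewrite /rat_padic_norm; case: (eqVneq x 0) => [_|_]; first exact: eqxx.
by rewrite expfz_eq0 (negbTE p_neq0) andbF.
Qed.

Lemma rat_padic_norm_gt0 x : (0 < nv x) = (x != 0).
Proof. by rewrite lt0r rat_padic_norm_eq0 rat_padic_norm_ge0 andbT. Qed.

Lemma rat_padic_norm_frac (m n : int) : m != 0 -> n != 0 ->
  nv (m%:~R / n%:~R) = p%:R ^ ((logn p `|n|)%:Z - (logn p `|m|)%:Z).
Proof.
move=> m0 n0; set x : rat := _ / _.
have n0' : n%:~R != 0 :> rat by rewrite intr_eq0.
have m0' : m%:~R != 0 :> rat by rewrite intr_eq0.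
have x0 : x != 0 by rewrite mulf_neq0 // invr_eq0.
rewrite /rat_padic_norm (negbTE x0); congr (_ ^ _).
have E : numq x * n = m * denq x.
  apply/(@intr_inj rat); rewrite !intrM numqE /x.
  by rewrite mulrAC divfK.
have num0 : numq x != 0 by rewrite numq_eq0.
have := congr1 (fun z => logn p `|z|%N) E.
rewrite !abszM !lognM ?absz_gt0 ?denq_neq0 // => F.
apply/eqP; rewrite subr_eq addrAC eq_sym subr_eq -!PoszD; apply/eqP.
by congr Posz; rewrite addnC F addnC.
Qed.

Lemma rat_padic_normM x y : nv (x * y) = nv x * nv y.
Proof.
have [->|x0] := eqVneq x 0; first by rewrite mul0r rat_padic_norm0 mul0r.
have [->|y0] := eqVneq y 0; first by rewrite mulr0 rat_padic_norm0 mulr0.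
have -> : x * y = (numq x * numq y)%:~R / (denq x * denq y)%:~R.
  by rewrite -{1}[x]divq_num_den -{1}[y]divq_num_den !intrM mulf_div.
rewrite rat_padic_norm_frac ?mulf_neq0 ?numq_eq0 ?denq_neq0 //.
rewrite !abszM !lognM ?absz_gt0 ?denq_neq0 ?numq_eq0 //.
rewrite /rat_padic_norm (negbTE x0) (negbTE y0) -expfzDr //; congr (_ ^ _).
by rewrite !PoszD opprD addrACA.
Qed.

Lemma rat_padic_normN x : nv (- x) = nv x.
Proof. by rewrite /rat_padic_norm oppr_eq0 numqN denqN abszN. Qed.

Lemma rat_padic_norm1 : nv 1 = 1.
Proof.
rewrite /rat_padic_norm oner_eq0 (_ : 1%R = 1%:~R :> rat) // numq_int denq_int.
by rewrite subrr.
Qed.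

Lemma rat_padic_normV x : nv x^-1 = (nv x)^-1.
Proof.
have [->|x0] := eqVneq x 0; first by rewrite invr0 rat_padic_norm0.
have nx0 : nv x != 0 by rewrite rat_padic_norm_eq0.
apply: (mulfI nx0).
by rewrite -rat_padic_normM !divff // rat_padic_norm1.
Qed.

Lemma rat_padic_normD x y : nv (x + y) <= Num.max (nv x) (nv y).
Proof.
have [->|x0] := eqVneq x 0; first by rewrite add0r le_max lexx orbT.
have [->|y0] := eqVneq y 0; first by rewrite addr0 le_max lexx.
have [->|xy0] := eqVneq (x + y) 0.
  by rewrite rat_padic_norm0 le_max rat_padic_norm_ge0.
pose d := denq x * denq y; pose A := numq x * denq y; pose B := numq y * denq x.
have d0 : d != 0 by rewrite mulf_neq0 ?denq_neq0.
have A0 : A != 0 by rewrite mulf_neq0 ?denq_neq0 ?numq_eq0.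
have B0 : B != 0 by rewrite mulf_neq0 ?denq_neq0 ?numq_eq0.
have dx : (denq x)%:~R != 0 :> rat by rewrite intr_eq0 denq_neq0.
have dy : (denq y)%:~R != 0 :> rat by rewrite intr_eq0 denq_neq0.
have xE : x = A%:~R / d%:~R.
  by rewrite !intrM -mulf_div divff // mulr1 divq_num_den.
have yE : y = B%:~R / d%:~R.
  by rewrite !intrM [X in _ / X]mulrC -mulf_div divff // mulr1 divq_num_den.
have xyE : x + y = (A + B)%:~R / d%:~R.
  by rewrite {1}xE {1}yE -mulrDl intrD.
have AB0 : A + B != 0.
  by apply: contra_neq xy0 => AB; rewrite xyE AB mul0r.
rewrite xyE {1}xE {1}yE !rat_padic_norm_frac //.
rewrite le_max !ler_eXz2l // !lerD2l !lerN2 !lez_nat -geq_min.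
set k := minn _ _.
rewrite -pfactor_dvdn ?absz_gt0 //.
have kA : (p ^ k %| `|A|)%N by rewrite pfactor_dvdn ?absz_gt0 // geq_minl.
have kB : (p ^ k %| `|B|)%N by rewrite pfactor_dvdn ?absz_gt0 // geq_minr.
suff : ((p ^ k)%N%:Z %| A + B)%Z by [].
by apply: rpredD.
Qed.

Lemma rat_padic_normB x y : nv (x - y) <= Num.max (nv x) (nv y).
Proof. by rewrite -(rat_padic_normN y) rat_padic_normD. Qed.

Lemma rat_padic_norm_dist x y : nv (x - y) = nv (y - x).
Proof. by rewrite -rat_padic_normN opprB. Qed.

Lemma rat_padic_norm_close x y : nv (x - y) < nv y -> nv x = nv y.
Proof.
move=> h; apply/eqP; rewrite eq_le; apply/andP; split.
  have := rat_padic_normD (x - y) y; rewrite subrK => /le_trans; apply.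
  by rewrite ge_max lexx andbT ltW.
have := rat_padic_normB x (x - y); rewrite subKr le_max => /orP[//|].
by move=> /le_lt_trans /(_ h); rewrite ltxx.
Qed.

End RatNorm.

Definition rat_cauchy (p : nat) (p_pr : prime p) : {pred nat -> rat} :=
  [pred u | `[< forall e : rat, 0 < e -> exists N : nat, forall m n : nat,
    (N <= m)%N -> (N <= n)%N -> rat_padic_norm p (u m - u n) < e >]].

Section CauchySeq.
Variables (p : nat) (p_pr : prime p).
Local Notation nv := (rat_padic_norm p).

Lemma rat_cauchyP u : reflect (forall e : rat, 0 < e -> exists N : nat,
    forall m n : nat, (N <= m)%N -> (N <= n)%N -> nv (u m - u n) < e)
  (u \in rat_cauchy p_pr).
Proof. exact: asboolP. Qed.

Lemma rat_cauchy_bounded u : u \in rat_cauchy p_pr ->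
  exists2 M, 0 < M & forall n, nv (u n) <= M.
Proof.
move=> /rat_cauchyP /(_ 1 ltr01)[N HN].
have S0 : 0 <= \sum_(i < N) nv (u i).
  by apply: sumr_ge0 => i _; exact: rat_padic_norm_ge0.
have u0 := rat_padic_norm_ge0 p (u N).
exists (1 + nv (u N) + \sum_(i < N) nv (u i)) => [|n]; first by lra.
have [nN|Nn] := ltnP n N.
  rewrite (bigD1 (Ordinal nN)) //=.
  have : 0 <= \sum_(i < N | i != Ordinal nN) nv (u i).
    by apply: sumr_ge0 => i _; exact: rat_padic_norm_ge0.
  by lra.
have := rat_padic_normD p_pr (u n - u N) (u N); rewrite subrK.
have := HN n N Nn (leqnn N).
by rewrite le_max => ? /orP[]; lra.
Qed.

Lemma rat_cauchy_subring : subring_closed (rat_cauchy p_pr).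
Proof.
split=> [|u v /rat_cauchyP hu /rat_cauchyP hv|u v cu cv].
- apply/rat_cauchyP => e e0; exists 0%N => m n _ _.
  by rewrite subrr rat_padic_norm0.
- apply/rat_cauchyP => e e0; have [N HN] := hu _ e0; have [M HM] := hv _ e0.
  exists (maxn N M) => m n; rewrite !geq_max => /andP[Nm Mm] /andP[Nn Mn].
  have -> : (u - v) m - (u - v) n = (u m - u n) - (v m - v n).
    by rewrite !fctE; ring.
  by rewrite (le_lt_trans (rat_padic_normB p_pr _ _)) // gt_max HN ?HM.
- have [A A0 hA] := rat_cauchy_bounded cu.
  have [B B0 hB] := rat_cauchy_bounded cv.
  apply/rat_cauchyP => e e0.
  have /rat_cauchyP/(_ _ (divr_gt0 e0 B0))[N HN] := cu.
  have /rat_cauchyP/(_ _ (divr_gt0 e0 A0))[M HM] := cv.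
  exists (maxn N M) => m n; rewrite !geq_max => /andP[Nm Mm] /andP[Nn Mn].
  have -> : (u * v) m - (u * v) n = u m * (v m - v n) + (u m - u n) * v n.
    by rewrite !fctE; ring.
  rewrite (le_lt_trans (rat_padic_normD p_pr _ _)) // gt_max.
  rewrite !rat_padic_normM //; apply/andP; split.
    rewrite (@le_lt_trans _ _ (A * nv (v m - v n))) //.
      by rewrite ler_wpM2r ?rat_padic_norm_ge0.
    by rewrite -ltr_pdivlMl // mulrC HM.
  rewrite (@le_lt_trans _ _ (nv (u m - u n) * B)) //.
    by rewrite ler_wpM2l ?rat_padic_norm_ge0.
  by rewrite -ltr_pdivlMr // HN.
Qed.

HB.instance Definition _ :=
  GRing.isSubringClosed.Build (nat -> rat) (rat_cauchy p_pr) rat_cauchy_subring.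

End CauchySeq.

Record cauchy_seq (p : nat) (p_pr : prime p) : Type :=
  CauchySeq { seq_of_cauchy :> nat -> rat;
              _ : seq_of_cauchy \in rat_cauchy p_pr }.

Section CauchyRing.
Variables (p : nat) (p_pr : prime p).
HB.instance Definition _ := [isSub for @seq_of_cauchy p p_pr].
HB.instance Definition _ := [Choice of cauchy_seq p_pr by <:].
HB.instance Definition _ :=
  [SubChoice_isSubComNzRing of cauchy_seq p_pr by <:].

Implicit Types u v : cauchy_seq p_pr.

Lemma cauchy_seqD u v n : (u + v) n = u n + v n.
Proof. by []. Qed.

Lemma cauchy_seqN u n : (- u) n = - u n.
Proof. by []. Qed.

Lemma cauchy_seqM u v n : (u * v) n = u n * v n.
Proof. by []. Qed.

End CauchyRing.

Definition null_seq (p : nat) (p_pr : prime p) : {pred cauchy_seq p_pr} :=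
  [pred u : cauchy_seq p_pr | `[< forall e : rat, 0 < e -> exists N : nat, forall n : nat,
    (N <= n)%N -> rat_padic_norm p (u n) < e >]].

Arguments null_seq [p] p_pr _.

Section NullIdeal.
Variables (p : nat) (p_pr : prime p).
Local Notation nv := (rat_padic_norm p).
Implicit Types u v : cauchy_seq p_pr.

Lemma null_seqP u : reflect (forall e : rat, 0 < e -> exists N : nat,
    forall n : nat, (N <= n)%N -> nv (u n) < e)
  (u \in null_seq p_pr).
Proof. exact: asboolP. Qed.

Lemma not_null_seq u : u \notin null_seq p_pr ->
  exists N, exists2 c, 0 < c & forall n, (N <= n)%N -> nv (u n) = c.
Proof.
move=> /null_seqP /existsNP[e /not_implyP[e0 /forallNP h]].
have /rat_cauchyP/(_ _ e0)[N HN] := valP u.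
have /existsNP[n0 /not_implyP[Nn0 /negP]] := h N; rewrite -leNgt => en0.
exists N, (nv (u n0)) => [|n Nn]; first exact: lt_le_trans e0 en0.
by apply: rat_padic_norm_close => //; exact: lt_le_trans (HN _ _ Nn Nn0) en0.
Qed.

Lemma null_seq_idealr : idealr_closed (null_seq p_pr).
Proof.
split=> [||a u v].
- by apply/null_seqP => e e0; exists 0%N => n _; rewrite rat_padic_norm0.
- apply/null_seqP => /(_ 1 ltr01)[N /(_ N (leqnn N))].
  by rewrite rat_padic_norm1 ltxx.
move=> /null_seqP hu /null_seqP hv; apply/null_seqP => e e0.
have [A A0 hA] := rat_cauchy_bounded (valP a).
have [N HN] := hu _ (divr_gt0 e0 A0); have [M HM] := hv _ e0.
exists (maxn N M) => n; rewrite geq_max => /andP[Nn Mn].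
rewrite cauchy_seqD cauchy_seqM.
rewrite (le_lt_trans (rat_padic_normD p_pr _ _)) // gt_max HM // andbT.
rewrite rat_padic_normM // (@le_lt_trans _ _ (A * nv (u n))) //.
  by rewrite ler_wpM2r ?rat_padic_norm_ge0 //; exact: hA.
by rewrite -ltr_pdivlMl // mulrC HN.
Qed.

HB.instance Definition _ :=
  isIdealr.Build (cauchy_seq p_pr) (null_seq p_pr) null_seq_idealr.

End NullIdeal.

(* The field Q_p, as the completion of the rationals: Cauchy sequences for the
   p-adic norm modulo null sequences. *)
Definition padic (p : nat) (p_pr : prime p) : Type :=
  {ideal_quot (null_seq p_pr)}.

Section PadicField.
Variables (p : nat) (p_pr : prime p).
Local Notation nv := (rat_padic_norm p).
Local Notation Qp := (padic p_pr).

HB.instance Definition _ := GRing.ComNzRing.on Qp.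
HB.instance Definition _ := NzRingQuotient.on Qp.

Local Notation pi := (\pi_Qp)%qT.

Lemma pi_padic_eq (u v : cauchy_seq p_pr) :
  (pi u == pi v) = (u - v \in null_seq p_pr).
Proof. by rewrite -Quotient.idealrBE. Qed.

Lemma pi_padic_eq0 (u : cauchy_seq p_pr) :
  (pi u == 0) = (u \in null_seq p_pr).
Proof. by rewrite -(rmorph0 pi) pi_padic_eq subr0. Qed.

Definition padic_inv (x : Qp) : Qp := xget 0 [set y | y * x = 1].

Lemma padic_mulVf x : x != 0 -> padic_inv x * x = 1.
Proof.
move=> x0; suff [y yx] : exists y, y * x = 1.
  by rewrite /padic_inv; case: xgetP => [z _ //|/(_ y)].
have := x0; rewrite -{1}[x]reprK pi_padic_eq0 => /not_null_seq[N [c c0 Nc]].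
have cinv : (fun n => (repr x n)^-1) \in rat_cauchy p_pr.
  apply/rat_cauchyP => e e0.
  have /rat_cauchyP/(_ (e * c * c))[|M HM] := valP (repr x).
    by rewrite !mulr_gt0.
  exists (maxn N M) => m n; rewrite !geq_max => /andP[Nm Mm] /andP[Nn Mn].
  have xm0 : repr x m != 0 by rewrite -(rat_padic_norm_gt0 p_pr) Nc.
  have xn0 : repr x n != 0 by rewrite -(rat_padic_norm_gt0 p_pr) Nc.
  have -> : (repr x m)^-1 - (repr x n)^-1 =
      (repr x n - repr x m) * ((repr x m)^-1 * (repr x n)^-1).
    by field; rewrite xm0 xn0.
  rewrite !rat_padic_normM // !rat_padic_normV // !Nc // -invfM.
  by rewrite ltr_pdivrMr ?mulr_gt0 // mulrA HM.
exists (pi (CauchySeq cinv)); rewrite -[X in _ * X = _]reprK -rmorphM -(rmorph1 pi).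
apply/eqP; rewrite pi_padic_eq; apply/null_seqP => e e0; exists N => n Nn.
have xn0 : repr x n != 0 by rewrite -(rat_padic_norm_gt0 p_pr) Nc.
rewrite cauchy_seqD cauchy_seqN cauchy_seqM /= mulVf //.
Qed.

Lemma padic_inv0 : padic_inv 0 = 0.
Proof.
rewrite /padic_inv; case: xgetP => // y _ /= /eqP.
by rewrite mulr0 eq_sym oner_eq0.
Qed.

HB.instance Definition _ :=
  GRing.ComNzRing_isField.Build Qp padic_mulVf padic_inv0.

End PadicField.

(* The p-adic norm extends from the rationals to Q_p by continuity; its values
   are taken in a field of reals R, where radii live. *)
Definition padic_norm (R : realType) (p : nat) (p_pr : prime p)
    (x : padic p_pr) : R :=
  limn (fun n => ratr (rat_padic_norm p ((repr x : cauchy_seq p_pr) n)) : R).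

Section PadicNorm.
Variables (R : realType) (p : nat) (p_pr : prime p).
Local Notation nv := (rat_padic_norm p).
Local Notation Qp := (padic p_pr).
Local Notation pi := (\pi_Qp)%qT.
Local Notation "`| x |_p" := (padic_norm R x) (at level 0, x at level 99).
Implicit Types (u v : cauchy_seq p_pr) (x y : Qp).

Lemma padic_norm0 : `|0 : Qp|_p = 0.
Proof.
have : repr (0 : Qp) \in null_seq p_pr by rewrite -pi_padic_eq0 reprK.
move=> /null_seqP h; apply/(@cvg_lim R^o) => //; apply/cvgrPdist_lt => e e0.
have [q] := rat_in_itvoo e0; rewrite in_itv /= ltr0q => /andP[q0 qe].
have [N HN] := h _ q0; exists N => // n /= /HN nq.
by rewrite sub0r normrN ger0_norm ?ler0q ?rat_padic_norm_ge0 //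
  (lt_trans _ qe) // ltr_rat.
Qed.

Lemma padic_normE u : pi u != 0 ->
  exists N, forall n, (N <= n)%N -> `|pi u|_p = ratr (nv (u n)).
Proof.
rewrite pi_padic_eq0 => /not_null_seq[N [c c0 Nc]].
have : repr (pi u) - u \in null_seq p_pr by rewrite -pi_padic_eq reprK.
move=> /null_seqP /(_ c c0)[M HM].
exists N => n /Nc ->; apply/(@cvg_lim R^o) => //; apply: cvg_near_cst.
exists (maxn N M) => // k /=; rewrite geq_max => /andP[Nk Mk].
congr ratr; rewrite -(Nc k Nk); apply: rat_padic_norm_close => //.
by rewrite Nc //; have := HM k Mk; rewrite cauchy_seqD cauchy_seqN.
Qed.

Lemma padic_norm_eq0 x : (`|x|_p == 0) = (x == 0).
Proof.
have [->|x0] := eqVneq x 0; first by rewrite padic_norm0 eqxx.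
have := x0; rewrite -[x]reprK pi_padic_eq0 => /not_null_seq[M [c c0 Mc]].
have := x0; rewrite -{1}[x]reprK => /padic_normE[N].
move=> /(_ (maxn N M)); rewrite leq_maxl => /(_ isT) ->.
by rewrite Mc ?leq_maxr // fmorph_eq0 gt_eqF.
Qed.

Lemma padic_norm_ge0 x : 0 <= `|x|_p.
Proof.
have [->|x0] := eqVneq x 0; first by rewrite padic_norm0.
move: x0; rewrite -[x]reprK => /padic_normE[N /(_ N (leqnn N)) ->].
by rewrite ler0q rat_padic_norm_ge0.
Qed.

Lemma padic_norm_val x : x != 0 -> exists k : int, `|x|_p = p%:R ^ k.
Proof.
move=> x0; have := x0; rewrite -{1}[x]reprK => /padic_normE[N].
move=> /(_ N (leqnn N)); rewrite reprK => xE.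
have : `|x|_p != 0 by rewrite padic_norm_eq0.
rewrite xE fmorph_eq0 /rat_padic_norm; case: ifPn => [|_ _]; first by rewrite eqxx.
by eexists; rewrite rmorphXz ?rmorph_nat ?unitfE ?pnatr_eq0 ?gtn_eqF ?prime_gt0.
Qed.

Lemma padic_normM x y : `|x * y|_p = `|x|_p * `|y|_p.
Proof.
have [->|x0] := eqVneq x 0; first by rewrite mul0r padic_norm0 mul0r.
have [->|y0] := eqVneq y 0; first by rewrite mulr0 padic_norm0 mulr0.
have := mulf_neq0 x0 y0; move: x0 y0.
rewrite -[x]reprK -[y]reprK -rmorphM.
move=> /padic_normE[N HN] /padic_normE[M HM] /padic_normE[K HK].
pose n := maxn N (maxn M K).
have [Nn Mn Kn] : [/\ (N <= n)%N, (M <= n)%N & (K <= n)%N].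
  by rewrite !leq_max !leqnn !orbT.
by rewrite (HN n) // (HM n) // (HK n) // cauchy_seqM rat_padic_normM // rmorphM.
Qed.

Lemma padic_normD x y : `|x + y|_p <= Num.max `|x|_p `|y|_p.
Proof.
have [->|x0] := eqVneq x 0; first by rewrite add0r le_max lexx orbT.
have [->|y0] := eqVneq y 0; first by rewrite addr0 le_max lexx.
have [->|xy0] := eqVneq (x + y) 0.
  by rewrite padic_norm0 le_max padic_norm_ge0.
move: x0 y0 xy0; rewrite -[x]reprK -[y]reprK -rmorphD.
move=> /padic_normE[N HN] /padic_normE[M HM] /padic_normE[K HK].
pose n := maxn N (maxn M K).
have [Nn Mn Kn] : [/\ (N <= n)%N, (M <= n)%N & (K <= n)%N].
  by rewrite !leq_max !leqnn !orbT.
rewrite (HN n) // (HM n) // (HK n) // cauchy_seqD.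
by have := rat_padic_normD p_pr (repr x n) (repr y n);
  rewrite !le_max !ler_rat.
Qed.

Lemma padic_norm_nat m : `|m%:R : Qp|_p = ratr (nv m%:R).
Proof.
have E n : (m%:R : cauchy_seq p_pr) n = m%:R.
  elim: m => [//|m IH]; rewrite mulrSr cauchy_seqD IH [RHS]mulrSr.
  by congr (_ + _).
have [m0|m0] := eqVneq (m%:R : Qp) 0.
  have : pi m%:R = 0 by rewrite rmorph_nat.
  move=> /eqP; rewrite pi_padic_eq0 => /null_seqP h.
  rewrite m0 padic_norm0; apply/esym/eqP; rewrite fmorph_eq0.
  rewrite eq_le rat_padic_norm_ge0 andbT leNgt; apply/negP => /h[N].
  by move=> /(_ N (leqnn N)); rewrite E ltxx.
move: m0; rewrite -(rmorph_nat pi) => /padic_normE[N /(_ N (leqnn N)) ->].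
by rewrite E.
Qed.

End PadicNorm.

Section Dynamics.
Variables (R : realType) (p : nat) (p_pr : prime p).
Local Notation Qp := (padic p_pr).
Implicit Types (f : Qp -> Qp) (F : {poly Qp}) (A B : set Qp) (c x y : Qp).
Implicit Types r rho : R.

Definition padic_ball c r : set Qp := [set x | padic_norm R (x - c) < r].

Definition padic_sphere c r : set Qp := [set x | padic_norm R (x - c) = r].

(* The points of A whose forward orbit, starting at time 0, meets B. *)
Definition visits f A B : set Qp :=
  [set x | A x /\ exists k : nat, B (iter k f x)].

Definition basin f x : set Qp :=
  [set y | padic_norm R (iter n f y - x) @[n --> \oo] --> (0 : R)].

(* F^`() is the formal derivative; for a polynomial map it is F'. *)
Definition indifferent_fixpoint F x : Prop :=
  F.[x] = x /\ padic_norm R F^`().[x] = 1.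

Definition repelling_fixpoint F x : Prop :=
  F.[x] = x /\ 1 < padic_norm R F^`().[x].

Definition siegel_disc f x r : Prop :=
  forall rho, 0 < rho < r ->
  forall y, padic_sphere x rho y ->
  forall n : nat, (1 <= n)%N -> padic_sphere x rho (iter n f y).

Definition siegel_union f x : set Qp :=
  \bigcup_(r in [set r | 0 < r /\ siegel_disc f x r]) padic_ball x r.

End Dynamics.

(* Main.v *)
Require Import Defs.
From HB Require Import structures.
From mathcomp Require Import all_boot all_order all_algebra.
From mathcomp Require Import all_classical all_reals all_analysis.
From mathcomp Require Import ring.
Import Order.TTheory GRing.Theory Num.Theory.
Import numFieldNormedType.Exports.

Set Implicit Arguments.
Unset Strict Implicit.
Unset Printing Implicit Defensive.

Local Open Scope classical_set_scope.
Local Open Scope ring_scope.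

(** Write A for the norm of a, so that A > 1, and factor f(x) = x^2 (x + a).
    By the ultrametric inequality |f(x)| is a function of |x| alone away from
    the sphere |x| = A: it is A |x|^2 inside and |x|^3 outside.  In terms of
    t = A |x| the inner regime is t |-> t^2: orbits starting with t < 1
    converge to 0, those with t = 1 keep their norm for ever, those with t > 1
    grow until they reach or jump over |x| = A, and beyond that sphere they
    only grow further.  On the sphere |x| = A itself, |f(x)| = A^2 |x + a| can
    be anything up to A^3.

    Basin of 0.  An orbit converges to 0 exactly when it enters |x| < 1/A.  The
    only way to enter from outside is through |x| = A, with A^2 |x + a| < 1/A,
    that is, through the ball of radius A^-3 around -a
    ([cubic_enters_small_ball]).  It remains to see which spheres can reach
    |x| = A: if j steps are needed then A^2 = t^(2^j), hence |x| = A for j = 0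
    and |x| = 1 for j = 1, whereas j >= 2 would make the square root of A a
    power of t, hence of p, which is excluded ([cubic_reaches_norm_a]).

    Siegel discs.  The equation x3^2 + a x3 = 1 leaves |x3| = A or
    |x3| = 1/A, and in the first case the multiplier would have norm A^2; so
    indifference forces |x3| = 1/A ([indifferent_root_norm]).  The exact
    expansion f(x3 + y) = x3 + l y + (3 x3 + a) y^2 + y^3, where |l| = 1 and
    |3 x3 + a| = A, is dominated by its linear term when |y| < 1/A, so all
    these spheres are invariant.  On |y| = 1/A the linear and quadratic terms
    have the same size, and y = - l / (3 x3 + a) makes them cancel, so that
    this sphere is not invariant and no Siegel disc is larger. *)

(** * The ultrametric norm *)

Section Ultrametric.
Variables (R : realType) (p : nat) (p_pr : prime p).
Local Notation Qp := (padic p_pr).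
Local Notation N := (padic_norm R).
Implicit Types x y : Qp.

Lemma padic_norm1 : N (1 : Qp) = 1.
Proof.
have n0 : N (1 : Qp) != 0 by rewrite padic_norm_eq0 oner_eq0.
by apply: (mulfI n0); rewrite -padic_normM !mulr1.
Qed.

Lemma padic_normX x n : N (x ^+ n) = N x ^+ n.
Proof.
elim: n => [|n IH]; first by rewrite !expr0 padic_norm1.
by rewrite !exprS padic_normM IH.
Qed.

Lemma padic_normN x : N (- x) = N x.
Proof.
apply/eqP; rewrite -(@eqrXn2 _ 2) ?padic_norm_ge0 //.
by rewrite -!padic_normX sqrrN.
Qed.

Lemma padic_normDr x y : N x < N y -> N (x + y) = N y.
Proof.
move=> xy; apply/eqP; rewrite eq_le; apply/andP; split.
  by apply: le_trans (padic_normD R x y) _; rewrite ge_max lexx ltW.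
have := padic_normD R (x + y) (- x); rewrite addrAC subrr add0r padic_normN.
by rewrite le_max leNgt => /orP[->//|]; rewrite leNgt xy.
Qed.

Lemma padic_normDl x y : N y < N x -> N (x + y) = N x.
Proof. by rewrite addrC; exact: padic_normDr. Qed.

Lemma padic_norm_nat_le1 n : N (n%:R : Qp) <= 1.
Proof.
elim: n => [|n IH]; first by rewrite padic_norm0 ler01.
rewrite mulrSr (le_trans (padic_normD _ _ _)) // ge_max IH /=.
by rewrite padic_norm1.
Qed.

Lemma padic_norm_natM n x : N (n%:R * x) <= N x.
Proof.
by rewrite padic_normM ler_piMl ?padic_norm_ge0 ?padic_norm_nat_le1.
Qed.

End Ultrametric.

(** * The norm along an orbit *)

Section CubicMap.
Variables (R : realType) (p : nat) (p_pr : prime p) (a : padic p_pr).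
Local Notation Qp := (padic p_pr).
Local Notation N := (padic_norm R).
Local Notation A := (N a).
Hypothesis a_gt1 : 1 < A.
Implicit Types x y : Qp.

Definition cubic x : Qp := x ^+ 2 * (x + a).

Let A_gt0 : 0 < A. Proof. exact: lt_trans ltr01 a_gt1. Qed.
Let A_neq0 : A != 0. Proof. exact: lt0r_neq0. Qed.
Let AV_gt0 : 0 < A^-1. Proof. by rewrite invr_gt0. Qed.
Let AV_lt1 : A^-1 < 1. Proof. by rewrite invf_lt1. Qed.

Lemma cubic_norm x : N (cubic x) = N x ^+ 2 * N (x + a).
Proof. by rewrite padic_normM padic_normX. Qed.

Lemma cubic_norm_inner x : N x < A -> N (cubic x) = A * N x ^+ 2.
Proof. by move=> xA; rewrite cubic_norm padic_normDr // mulrC. Qed.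

Lemma cubic_norm_outer x : A < N x -> N (cubic x) = N x ^+ 3.
Proof. by move=> xA; rewrite cubic_norm padic_normDl // -exprSr. Qed.

Lemma cubic_outer x n : A < N x -> A < N (iter n cubic x).
Proof.
move=> xA; elim: n => // n IH; rewrite iterS cubic_norm_outer //.
by apply: (lt_trans IH); rewrite ltr_eXnr // (lt_trans a_gt1).
Qed.

(** In the variable t = A |x| the inner regime is plain squaring. *)
Lemma cubic_iter_norm_inner x n :
  (forall i, (i < n)%N -> N (iter i cubic x) < A) ->
  A * N (iter n cubic x) = (A * N x) ^+ (2 ^ n).
Proof.
elim: n => [_|n IH inner]; first by rewrite expn0 expr1.
rewrite iterS cubic_norm_inner ?inner // mulrA -expr2 -exprMn.
by rewrite IH ?expnSr ?exprM // => i /ltnW; exact: inner.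
Qed.

(** The factor A |x| < 1 contracts at least geometrically. *)
Lemma cubic_iter_small x n : N x < A^-1 ->
  N (iter n cubic x) <= (A * N x) ^+ n * N x.
Proof.
move=> xs; have tlt1 : A * N x < 1 by rewrite mulrC -ltr_pdivlMr ?div1r.
have t0 : 0 <= A * N x by rewrite mulr_ge0 ?padic_norm_ge0 // ltW.
elim: n => [|n IH]; first by rewrite expr0 mul1r.
have yx : N (iter n cubic x) <= N x.
  apply: (le_trans IH); rewrite ler_piMl ?padic_norm_ge0 //.
  by rewrite exprn_ile1 // ltW.
rewrite iterS cubic_norm_inner; last first.
  by rewrite (le_lt_trans yx) // (lt_trans xs) // (lt_trans AV_lt1).
rewrite expr2 mulrA exprS -[leRHS]mulrA.
apply: ler_pM => //; first by rewrite mulr_ge0 ?padic_norm_ge0 // ltW.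
- exact: padic_norm_ge0.
- by rewrite ler_wpM2l // ltW.
Qed.

(** * The basin of attraction of zero *)

Lemma basin_small_ball x k :
  N (iter k cubic x) < A^-1 -> basin R cubic 0 x.
Proof.
set y := iter k cubic x => ys.
suff : N (iter n cubic x) @[n --> \oo] --> (0 : R).
  by rewrite /basin /=; under [in X in _ -> X]eq_fun do rewrite subr0.
rewrite -(@cvg_shiftn k R (fun n => N (iter n cubic x))).
have t0 : 0 <= A * N y by rewrite mulr_ge0 ?padic_norm_ge0 // ltW.
have tlt1 : A * N y < 1 by rewrite mulrC -ltr_pdivlMr ?div1r.
apply: (@squeeze_cvgr _ _ _ _ (fun=> 0) (fun n => (A * N y) ^+ n * N y)).
- near=> n; rewrite padic_norm_ge0 /= iterD.
  exact: cubic_iter_small.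
- exact: cvg_cst.
- rewrite -[X in _ --> X](mul0r (N y)); apply: cvgM; last exact: cvg_cst.
  by apply: cvg_expr; rewrite ger0_norm.
Unshelve. all: by end_near.
Qed.

(** Off the sphere |y| = A, |y| >= 1/A forces |f(y)| >= |y|; on it, |f(y)| is
    A^2 |y + a|. *)
Lemma cubic_enters_small_ball y : A^-1 <= N y -> N (cubic y) < A^-1 ->
  N (y - - a) < A ^- 3.
Proof.
rewrite opprK => yl fys; have [yA|yA|yA] := ltgtP (N y) A.
- suff : A^-1 <= N (cubic y) by rewrite leNgt fys.
  rewrite cubic_norm_inner // (le_trans yl) // expr2 mulrA.
  by rewrite ler_peMl ?padic_norm_ge0 // -ler_pdivrMl // mulr1.
- suff : A < A^-1 by rewrite ltNge (ltW (lt_trans AV_lt1 a_gt1)).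
  exact: lt_trans (cubic_outer 1 yA) fys.
- move: fys; rewrite cubic_norm yA mulrC -ltr_pdivlMr ?exprn_gt0 //.
  by rewrite -invfM -exprS.
Qed.

Lemma near_minus_a_norm y : N (y - - a) < A ^- 3 -> N y = A.
Proof.
move=> ya; rewrite -[y](subrK (- a)) padic_normDr padic_normN //.
rewrite (lt_trans ya) // (lt_trans _ a_gt1) // invf_lt1 ?exprn_gt0 //.
by rewrite exprn_egt1.
Qed.

Lemma cubic_near_minus_a y : N (y - - a) < A ^- 3 -> N (cubic y) < A^-1.
Proof.
move=> ya; rewrite cubic_norm (near_minus_a_norm ya).
by move: ya; rewrite opprK exprS invfM -ltr_pdivlMl ?exprn_gt0 // mulrC.
Qed.

(** Norms before the orbit first leaves |x| < A are obtained by squaring, so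
    A^2 is a 2^j-th power of A |x|, where j is the time of arrival. *)
Lemma cubic_reaches_norm_a x k :
  (forall n : nat, Num.sqrt A <> p%:R ^+ n) ->
  N (iter k cubic x) = A -> N x = 1 \/ N x = A.
Proof.
move=> A_sqrt kA.
have exA : exists j, ~~ (N (iter j cubic x) < A).
  by exists k; rewrite kA ltxx.
case: (ex_minnP exA) => j; rewrite -leNgt => Aj jmin.
have jk : (j <= k)%N by apply: jmin; rewrite kA ltxx.
have {Aj} jA : N (iter j cubic x) = A.
  apply/eqP; rewrite eq_le Aj andbT leNgt; apply/negP => /(cubic_outer (k - j)).
  by rewrite -iterD subnK // kA ltxx.
have inner i : (i < j)%N -> N (iter i cubic x) < A.
  by rewrite ltnNge; apply: contraNT => /jmin.
have := cubic_iter_norm_inner inner; rewrite jA.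
case: j {jA inner jmin jk} => [|[|i]].
- by rewrite expn0 expr1 => /(mulfI A_neq0) ->; right.
- rewrite expn1 -expr2 => /eqP.
  rewrite eqrXn2 ?mulr_ge0 ?padic_norm_ge0 //; try exact: ltW.
  by rewrite -{1}[A]mulr1 => /eqP /(mulfI A_neq0) <-; left.
have t0 : 0 <= A * N x by rewrite mulr_ge0 ?padic_norm_ge0 // ltW.
rewrite expnSr exprM -expr2 => /eqP.
(* Cancelling a square leaves A = (t^(2^i))^2, where t is a power of p. *)
rewrite eqrXn2 ?exprn_ge0 //; last exact: ltW.
move=> /eqP At.
have xa : a * x != 0.
  rewrite -(padic_norm_eq0 R) padic_normM; apply: contra_neq A_neq0 => tx.
  by rewrite At tx expr0n expn_eq0.
have [m tm] := padic_norm_val R xa; rewrite padic_normM in tm.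
have tgt1 : 1 < A * N x.
  rewrite ltNge; apply/negP => tle1.
  by have := a_gt1; rewrite At ltNge exprn_ile1.
case: m tm => m tm; last first.
  (* A negative exponent would make t at most 1. *)
  move: tgt1; rewrite tm ltNge -[_ ^ _]/(_ ^- _) -exprVn.
  rewrite exprn_ile1 ?invr_ge0 ?ler0n //.
  by rewrite invf_le1 ?ltr0n ?ler1n prime_gt0.
case: (A_sqrt (m * 2 ^ i)%N).
by rewrite At expnSr exprM sqrtr_sqr ger0_norm ?exprn_ge0 // tm exprM.
Qed.

Lemma basin_cubic : (forall n : nat, Num.sqrt A <> p%:R ^+ n) ->
  basin R cubic 0 = padic_ball 0 (A ^- 1) `|`
    visits cubic (padic_sphere 0 (A ^- 0) `|` padic_sphere 0 A)
           (padic_ball (- a) (A ^- 3)).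
Proof.
move=> A_sqrt; rewrite expr1 expr0 invr1; apply/seteqP; split=> x.
  move=> /cvgr0Pnorm_lt /(_ _ AV_gt0)[n0 _ small].
  have exn : exists n, N (iter n cubic x) < A^-1.
    exists n0; have := small n0 (leqnn n0).
    by rewrite subr0 ger0_norm ?padic_norm_ge0.
  case: (ex_minnP exn) => -[|k] ks kmin.
    by left; rewrite /padic_ball /= subr0.
  have ka : padic_ball (- a) (A ^- 3) (iter k cubic x).
    apply: cubic_enters_small_ball => //.
    by rewrite leNgt; apply/negP => /kmin; rewrite ltnn.
  right; split; last by exists k.
  by rewrite /padic_sphere /= subr0; apply: cubic_reaches_norm_a
    (near_minus_a_norm ka).
move=> [|[_ [k ka]]].
  by rewrite /padic_ball /= subr0; exact: (@basin_small_ball _ 0).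
by apply: (@basin_small_ball _ k.+1); exact: cubic_near_minus_a.
Qed.

(** * Siegel discs at the indifferent fixed point *)

(** f'(c) = 3 c^2 + 2 a c, factored so that its norm is a product of norms. *)
Definition multiplier (c : Qp) : Qp := c * (3%:R * c + 2%:R * a).

Lemma cubic_expansion c y : cubic c = c ->
  cubic (c + y) - c = multiplier c * y + (3%:R * c + a) * y ^+ 2 + y ^+ 3.
Proof. by rewrite /multiplier => {2}<-; rewrite /cubic; ring. Qed.

(** The equation reads c (c + a) = 1, so |c| < A gives |c| A = 1 and |c| > A
    is impossible.  If |c| = A then |c + a| = 1/A, so 3c + 2a = 3(c + a) - a
    has norm A and the multiplier has norm A^2. *)
Lemma indifferent_root_norm c :
  c ^+ 2 + a * c = 1 -> N (multiplier c) = 1 -> N c = A^-1.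
Proof.
move=> cE; have : N c * N (c + a) = 1.
  by rewrite -padic_normM mulrDr -expr2 [c * a]mulrC cE padic_norm1.
have [cA|cA|cA] := ltgtP (N c) A.
- by rewrite padic_normDr // => /(canRL (mulfK A_neq0)); rewrite div1r.
- rewrite padic_normDl // => c1.
  have c_gt1 := lt_trans a_gt1 cA.
  by have := mulr_egt1 c_gt1 c_gt1; rewrite c1 ltxx.
rewrite cA => /(canRL (mulKf A_neq0)); rewrite mulr1 => ca.
rewrite padic_normM cA.
have -> : 3%:R * c + 2%:R * a = 3%:R * (c + a) + - a by ring.
rewrite padic_normDr padic_normN => [A1|].
  by have := mulr_egt1 a_gt1 a_gt1; rewrite A1 ltxx.
by rewrite (le_lt_trans (padic_norm_natM _ _ _)) // ca (lt_trans AV_lt1).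
Qed.

Section Indifferent.
Variable c : Qp.
Hypotheses (c_fix : cubic c = c) (c_norm : N c = A^-1)
  (c_indiff : N (multiplier c) = 1).

Let quadratic_coef_norm : N (3%:R * c + a) = A.
Proof.
rewrite padic_normDr // (le_lt_trans (padic_norm_natM _ _ _)) //.
by rewrite c_norm (lt_trans AV_lt1).
Qed.

Lemma cubic_isometric_near x : N (x - c) < A^-1 -> N (cubic x - c) = N (x - c).
Proof.
move=> xs; rewrite -{1}[x](subrKC c) cubic_expansion //.
move: (x - c) xs => y ys.
have [->|y0] := eqVneq y 0; first by rewrite !expr0n !mulr0 !addr0.
have yp : 0 < N y by rewrite lt0r padic_norm_eq0 y0 padic_norm_ge0.
have lin : N (multiplier c * y) = N y by rewrite padic_normM c_indiff mul1r.
have quad : N ((3%:R * c + a) * y ^+ 2) < N y.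
  rewrite padic_normM quadratic_coef_norm padic_normX expr2 mulrA.
  by rewrite gtr_pMl // -ltr_pdivlMl // mulr1.
have cub : N (y ^+ 3) < N y.
  by rewrite padic_normX ltr_iXnr // (lt_trans ys).
by rewrite !padic_normDl ?lin.
Qed.

Lemma siegel_disc_cubic : siegel_disc cubic c A^-1.
Proof.
move=> rho /andP[_ rhoA] y /= yrho n _; rewrite /padic_sphere /=.
elim: n => [//|n IH]; by rewrite iterS cubic_isometric_near IH.
Qed.

(** At y = - l / (3c + a) the linear and quadratic terms cancel and only y^3,
    of norm A^-3, is left. *)
Lemma siegel_disc_cubic_le r : siegel_disc cubic c r -> r <= A^-1.
Proof.
move=> Sr; rewrite leNgt; apply/negP => rA.
pose b := 3%:R * c + a; have bA : N b = A := quadratic_coef_norm.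
have b0 : b != 0 by rewrite -(padic_norm_eq0 R) bA.
pose l := multiplier c.
pose y := - l / b; have by_eq : b * y = - l by rewrite mulrC divfK.
have yA : N y = A^-1.
  apply: (mulfI A_neq0); rewrite -{1}bA -padic_normM by_eq.
  by rewrite padic_normN c_indiff divff.
have := Sr A^-1 _ (c + y) _ 1%N isT; rewrite AV_gt0 rA /padic_sphere /=.
rewrite cubic_expansion // addrAC subrr add0r -/b -/l.
have -> : l * y + b * y ^+ 2 + y ^+ 3 = y ^+ 3.
  by rewrite expr2 (mulrA b) by_eq mulNr subrr add0r.
rewrite padic_normX yA => /(_ isT erefl) A3.
by have : A^-1 ^+ 3 < A^-1; [rewrite ltr_iXnr|rewrite A3 ltxx].
Qed.

Lemma siegel_union_cubic : siegel_union R cubic c = padic_ball c A^-1.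
Proof.
apply/seteqP; split=> x.
  move=> [r [_ /siegel_disc_cubic_le rA]] xr; exact: lt_le_trans xr rA.
by move=> xA; exists A^-1 => //; split => //; exact: siegel_disc_cubic.
Qed.

End Indifferent.

End CubicMap.

Theorem theorem5p3 (R : realType) (p : nat) (p_pr : prime p) (a : padic p_pr)
    (a_gt1 : 1 < padic_norm R a)
    (a_sqrt : forall k : nat, Num.sqrt (padic_norm R a) <> p%:R ^+ k) :
  let F : {poly padic p_pr} := 'X^3 + a *: 'X^2 in
  let f : padic p_pr -> padic p_pr := fun x => F.[x] in
  let r : nat -> R := fun k => (padic_norm R a) ^- k in
  basin R f 0 =
    padic_ball 0 (r 1%N) `|`
    visits f (padic_sphere 0 (r 0%N) `|` padic_sphere 0 (padic_norm R a))
             (padic_ball (- a) (r 3%N))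
  /\
  forall x2 x3 : padic p_pr,
    'X^2 + a *: 'X - 1 = ('X - x2%:P) * ('X - x3%:P) ->
    repelling_fixpoint R F x2 -> indifferent_fixpoint R F x3 ->
    siegel_union R f x3 = padic_ball x3 (r 1%N).
Proof.
move=> F f r.
have fE : f = cubic a.
  by apply/funext => x; rewrite /f /F /cubic hornerD hornerZ !hornerXn; ring.
split; first by rewrite fE; exact: basin_cubic.
move=> x2 x3 roots _ [x3_fix x3_indiff].
have {}x3_fix : cubic a x3 = x3 by rewrite -fE.
have {}x3_indiff : padic_norm R (multiplier a x3) = 1.
  rewrite -x3_indiff; congr padic_norm.
  rewrite /F /multiplier derivD derivZ !derivXn.
  by rewrite !(hornerD, hornerZ, hornerMn, hornerXn) /=; ring.
have x3_root : x3 ^+ 2 + a * x3 = 1.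
  have /eqP := congr1 (horner^~ x3) roots.
  by rewrite !hornerE subrr mulr0 subr_eq0 => /eqP.
rewrite fE /r expr1; apply: siegel_union_cubic => //.
exact: indifferent_root_norm.
Qed.
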